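(* Let $\mathcal{T}=(Q,q_0,\Delta,\omega,\Pi,h)$ be a finite non-blocking weighted deterministic transition system and $\phi$ a linear temporal logic (LTL) formula over $\Pi$. Assume that there exists a trajectory of $\mathcal{T}$ originating from $q_0$ that satisfies $\phi$. Then the receding horizon control algorithm described in the context, applied to $\mathcal{T}$ and $\phi$, produces an infinite trajectory $\mathbf{q}=q_0q_1\ldots$ of $\mathcal{T}$ satisfying $\phi$.
   Context: **Transition system.** A finite weighted deterministic transition system (DTS) is $\mathcal{T}=(Q,q_0,\Delta,\omega,\Pi,h)$ with $Q$ a finite set of states, $q_0\in Q$ the initial state, $\Delta\subseteq Q\times Q$ the transitions, $\omega:\Delta\to\mathbb{R}^+$ a weight function assigning positive values, $\Pi$ a set of observations, and $h:Q\to 2^\Pi$ the observation map. Write $q\to_{\mathcal{T}}q'$ if $(q,q')\in\Delta$. $\mathcal{T}$ is assumed non-blocking: every $q\in Q$ has some $q'$ with $q\to_{\mathcal{T}}q'$. A trajectory is an infinite sequence $\mathbf{q}=q_0q_1\ldots$ with $q_k\to_{\mathcal{T}}q_{k+1}$ for all $k\ge0$; it satisfies an LTL formula $\phi$ over $\Pi$ if the output sequence $h(q_0)h(q_1)\ldots$ (over $2^\Pi$) satisfies $\phi$ under the standard LTL semantics. **Büchi automaton.** $\mathcal{B}=(S_{\mathcal{B}},S_{\mathcal{B}0},2^{\Pi},\delta_{\mathcal B},F_{\mathcal{B}})$ with $S_{\mathcal B}$ a finite set of states, $S_{\mathcal{B}0}\subseteq S_{\mathcal B}$ initial states, $\delta_{\mathcal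 B}:S_{\mathcal{B}}\times 2^{\Pi}\to 2^{S_{\mathcal{B}}}$ the transition function, $F_{\mathcal{B}}\subseteq S_{\mathcal{B}}$ accepting states. Write $s\xrightarrow{\sigma}_{\mathcal{B}}s'$ if $s'\in\delta_{\mathcal B}(s,\sigma)$. $\mathcal{B}$ accepts an infinite sequence $\sigma_0\sigma_1\ldots$ if there is a sequence $s_0s_1\ldots$ with $s_0\in S_{\mathcal{B}0}$, $s_k\xrightarrow{\sigma_k}_{\mathcal{B}}s_{k+1}$ for all $k\geq 0$, visiting $F_{\mathcal{B}}$ infinitely many times. **Product automaton.** $\mathcal{P}=\mathcal{T}\times\mathcal{B}=(S_{\mathcal{P}},S_{\mathcal{P}0},\Delta_{\mathcal{P}},\omega_{\mathcal{P}},F_{\mathcal{P}})$ with $S_{\mathcal{P}}=Q\times S_{\mathcal{B}}$, $S_{\mathcal{P}0}=\{q_0\}\times S_{\mathcal{B}0}$, $((q,s),(q',s'))\in\Delta_{\mathcal{P}}$ iff $q\to_{\mathcal{T}}q'$ and $s\xrightarrow{h(q)}_{\mathcal{B}}s'$, $\omega_{\mathcal{P}}((q,s),(q',s'))=\omega((q,q'))$, $F_{\mathcal{P}}=Q\times F_{\mathcal{B}}$. Write $p\to_{\mathcal{P}}p'$ if $(p,p')\in\Delta_{\mathcal{P}}$. The projection $\gamma_{\mathcal{T}}$ removes automaton states: $\gamma_{\mathcal{T}}((q,s))=q$, applied componentwise to sequences. **Energy function.** $A\subseteq S_{\mathcal{P}}$ is self-reachable iff every state in $A$ can reach at least one state in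 $A$ (by a path with at least one transition). $F^\star_{\mathcal{P}}$ is the largest self-reachable subset of $F_{\mathcal{P}}$. $V(p)$ is the accumulated $\omega_{\mathcal{P}}$-weight of the shortest path from $p$ to any state in $F^\star_{\mathcal{P}}$ ($0$ if $p\in F^\star_{\mathcal{P}}$, $\infty$ if no such path exists). **Predicted trajectories and rewards.** Fix a horizon $N\geq1$. $\mathbf{P}(p_k,N)$ is the set of finite sequences $\mathbf{p}_k=p_{1|k}\ldots p_{N|k}$ in $S_{\mathcal{P}}$ with $p_k\to_{\mathcal{P}}p_{1|k}$ and $p_{i|k}\to_{\mathcal{P}}p_{i+1|k}$ for $i=1,\ldots,N-1$. The reward process is a function $\mathcal{R}:Q\times\mathbb{N}\to\mathbb{R}^+$ (otherwise arbitrary), and $\mathcal{N}(q,k)\subseteq Q$ is the neighborhood observable from $q$ at time $k$. With $q_k=\gamma_{\mathcal{T}}(p_k)$, set $R_k(q)=\mathcal{R}(q,k)$ if $q\in\mathcal{N}(q_k,k)$ and $R_k(q)=0$ otherwise; the predicted reward is $\Re_k(\mathbf{p}_k)=\sum_{i=1}^N R_k(\gamma_{\mathcal{T}}(p_{i|k}))$. **Controllers** (each returns a maximizer). - Time $0$: $\mathbf{p}_0^\star=\mathtt{RH}^0(S_{\mathcal{P}0})$ is a maximizer of $\Re_0(\mathbf{p}_0)$ over all $\mathbf{p}_0\in\mathbf{P}(p_0,N)$ with $p_0\in S_{\mathcal{P}0}$ and $V(p_0)<\infty$. - Time $k\ge1$: $p_k=p^\star_{1|k-1}$, where $\mathbf{p}^\star_{k-1}=p^\star_{1|k-1}\ldots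 p^\star_{N|k-1}$ is the optimal predicted trajectory returned at time $k-1$, and $\mathbf{p}^\star_k=\mathtt{RH}(p_k,\mathbf{p}^\star_{k-1})$ is a maximizer of $\Re_k(\mathbf{p}_k)$ over $\mathbf{p}_k\in\mathbf{P}(p_k,N)$ subject to: - Case 1 ($V(p_k)>0$ and $V(p^\star_{i|k-1})\ne0$ for all $i=1,\ldots,N$): $V(p_{N|k})<V(p^\star_{N|k-1})$; - Case 2 ($V(p_k)>0$ and $V(p^\star_{i|k-1})=0$ for some $i\in\{1,\ldots,N\}$): $V(p_{i^0-1|k})=0$, where $i^0=i^0(\mathbf{p}^\star_{k-1})$ is the smallest index $i$ with $V(p^\star_{i|k-1})=0$ (here $i^0\geq 2$ since $V(p^\star_{1|k-1})=V(p_k)>0$); - Case 3 ($V(p_k)=0$): $V(p_{N|k})<\infty$. **Algorithm.** Off-line: construct a Büchi automaton $\mathcal{B}$ accepting all and only the infinite sequences over $2^\Pi$ that satisfy $\phi$; construct $\mathcal{P}=\mathcal{T}\times\mathcal{B}$ and compute $V$. On-line: if no $p_0\in S_{\mathcal{P}0}$ has $V(p_0)\neq\infty$, report that no run from $q_0$ satisfies $\phi$. Otherwise, at time $0$ observe the rewards, compute $\mathbf{p}^\star_0=\mathtt{RH}^0(S_{\mathcal{P}0})$ (with $p_0$ the corresponding initial state), and apply the transition $(p_0,p^\star_{1|0})$ on $\mathcal{P}$ and $(q_0,\gamma_{\mathcal{T}}(p^\star_{1|0}))$ on $\mathcal{T}$. Then for $k=1,2,\ldots$ observe the rewards, compute $\mathbf{p}^\star_k=\mathtt{RH}(p_k,\mathbf{p}^\star_{k-1})$,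 and apply $(p_k,p^\star_{1|k})$ on $\mathcal{P}$ and $(q_k,\gamma_{\mathcal{T}}(p^\star_{1|k}))$ on $\mathcal{T}$. The produced trajectory is $\mathbf{q}=\gamma_{\mathcal{T}}(p_0p_1p_2\ldots)$.
   Formalization: Solvability of the problem at time 1 is claimed only when the state p_1 reached after time 0 has V(p_1)<∞; the time-0 controller as described does not ensure this, and without it the algorithm can get stuck at time 1. *)

(* Defs.v *)
From mathcomp Require Import all_boot all_order all_algebra.
From mathcomp Require Import all_classical reals ereal.

Set Implicit Arguments.
Unset Strict Implicit.
Unset Printing Implicit Defensive.

Import Order.TTheory GRing.Theory Num.Theory.
Local Open Scope ring_scope.

(* [weight] is total on pairs of states; its value is meaningful, and required
   to be positive, on transitions only. *)
Record dts (R : realType) (Pi : Type) := DTS {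
  state :> finType;
  init : state;
  trans : rel state;
  weight : state -> state -> R;
  weight_gt0 : forall q q', trans q q' -> 0 < weight q q';
  obs : state -> set Pi
}.

Definition non_blocking (R : realType) (Pi : Type) (T : dts R Pi) : Prop :=
  forall q : T, exists q' : T, trans q q'.

Definition trajectory (R : realType) (Pi : Type) (T : dts R Pi)
    (q : nat -> T) : Prop :=
  q 0%N = init T /\ forall k, trans (q k) (q k.+1).

(* The remaining connectives (or, implies, eventually, always) are the usual
   abbreviations. *)
Inductive ltl (Pi : Type) :=
  | LTrue
  | LAtom of Pi
  | LNot of ltl Pi
  | LAnd of ltl Pi & ltl Pi
  | LNext of ltl Pi
  | LUntil of ltl Pi & ltl Pi.

Fixpoint sat_at (Pi : Type) (w : nat -> set Pi) (i : nat) (phi : ltl Pi) :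
    Prop :=
  match phi with
  | LTrue => True
  | LAtom a => w i a
  | LNot f => ~ sat_at w i f
  | LAnd f g => sat_at w i f /\ sat_at w i g
  | LNext f => sat_at w i.+1 f
  | LUntil f g => exists j, [/\ (i <= j)%N, sat_at w j g &
      forall k, (i <= k < j)%N -> sat_at w k f]
  end.

Definition sat (Pi : Type) (w : nat -> set Pi) (phi : ltl Pi) : Prop :=
  sat_at w 0 phi.

Definition trajectory_sat (R : realType) (Pi : Type) (T : dts R Pi)
    (q : nat -> T) (phi : ltl Pi) : Prop :=
  sat (fun k => obs (q k)) phi.

Record buchi (Pi : Type) := Buchi {
  bstate :> finType;
  binit : {set bstate};
  bdelta : bstate -> set Pi -> {set bstate};
  bacc : {set bstate}
}.

Definition accepts (Pi : Type) (B : buchi Pi) (w : nat -> set Pi) : Prop :=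
  exists s : nat -> B,
    [/\ s 0%N \in binit B,
        forall k, s k.+1 \in bdelta (s k) (w k) &
        forall n, exists m, (n <= m)%N /\ s m \in bacc B].

Definition buchi_for (Pi : Type) (B : buchi Pi) (phi : ltl Pi) : Prop :=
  forall w, accepts B w <-> sat w phi.

Section Product.
Variables (R : realType) (Pi : Type) (T : dts R Pi) (B : buchi Pi).

Definition pstate : finType := (T * B)%type.

Definition pinit : {set pstate} := [set p | (p.1 == init T) && (p.2 \in binit B)].

Definition ptrans : rel pstate :=
  fun p p' => trans p.1 p'.1 && (p'.2 \in bdelta p.2 (obs p.1)).

Definition pweight (p p' : pstate) : R := weight p.1 p'.1.

Definition pacc : {set pstate} := [set p | p.2 \in bacc B].

Definition self_reachable (A : {set pstate}) : bool :=
  [forall p in A, [exists p1, ptrans p p1 &&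
     [exists p' in A, connect ptrans p1 p']]].

(* The union of all self-reachable subsets of [pacc] is the largest one; see
   [Fstar_sub], [Fstar_self_reachable] and [Fstar_max]. *)
Definition Fstar : {set pstate} :=
  \bigcup_(A : {set pstate} | (A \subset pacc) && self_reachable A) A.

Lemma Fstar_sub : Fstar \subset pacc.
Proof. by apply/bigcupsP => A /andP[]. Qed.

Lemma Fstar_max (A : {set pstate}) :
  A \subset pacc -> self_reachable A -> A \subset Fstar.
Proof. by move=> Aacc Ar; apply: finset.bigcup_sup; rewrite Aacc. Qed.

Lemma Fstar_self_reachable : self_reachable Fstar.
Proof.
apply/forall_inP => p /bigcupP[A HA pA].
have /andP[Aacc Ar] := HA.
have /existsP[p1 /andP[pp1 /exists_inP[p' p'A p1p']]] := forall_inP Ar p pA.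
apply/existsP; exists p1; rewrite pp1 /=; apply/exists_inP; exists p' => //.
exact: fintype.subsetP (Fstar_max Aacc Ar) _ p'A.
Qed.

(* Accumulated weight of the path [p :: s]. *)
Definition path_weight (p : pstate) (s : seq pstate) : R :=
  \sum_(e <- zip (p :: s) s) pweight e.1 e.2.

(* [+oo] is the infimum of the empty set. *)
Definition V (p : pstate) : \bar R :=
  if p \in Fstar then 0%E else
  ereal_inf [set (path_weight p s)%:E |
    s in [set s | path ptrans p s /\ last p s \in Fstar]]%classic.

Variables (N : nat) (rew : T -> nat -> R) (nbh : T -> nat -> {set T}).

(* In a prediction [t : N.-tuple pstate] from [p], the state p_{i|k} is
   [nth p (p :: t) i] for 1 <= i <= N (hence the next state p_{1|k} is
   [head p t] and p_{N|k} is [last p t] as soon as N >= 1). *)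
Definition predicted (p : pstate) : {set N.-tuple pstate} :=
  [set t : N.-tuple pstate | path ptrans p t].

Definition observed_reward (k : nat) (qk q : T) : R :=
  if q \in nbh qk k then rew q k else 0.

Definition predicted_reward (k : nat) (p : pstate) (t : N.-tuple pstate) : R :=
  \sum_(p' <- t) observed_reward k p.1 p'.1.

Definition admissible0 (p : pstate) (t : N.-tuple pstate) : bool :=
  [&& p \in pinit, (V p < +oo)%E & t \in predicted p].

Definition RH0 (p : pstate) (t : N.-tuple pstate) : Prop :=
  admissible0 p t /\
  forall p' t', admissible0 p' t' ->
    predicted_reward 0 p' t' <= predicted_reward 0 p t.

(* Smallest i >= 1 with V(p_{i|k}) = 0 along the prediction. *)
Definition first_zero (t : N.-tuple pstate) : nat :=
  (find (fun p => V p == 0%E) t).+1.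

Definition admissible (p : pstate) (prev t : N.-tuple pstate) : bool :=
  [&& t \in predicted p,
      (0 < V p)%E && all (fun p' => V p' != 0%E) prev ==>
        (V (last p t) < V (last p prev))%E,
      (0 < V p)%E && has (fun p' => V p' == 0%E) prev ==>
        (V (nth p (p :: t) (first_zero prev).-1) == 0%E) &
      (V p == 0%E) ==> (V (last p t) < +oo)%E].

Definition RH (k : nat) (p : pstate) (prev t : N.-tuple pstate) : Prop :=
  admissible p prev t /\
  forall t', admissible p prev t' ->
    predicted_reward k p t' <= predicted_reward k p t.

(* [ts k] is the optimal prediction returned at time k; [current p0 ts k] is
   the state p_k of the product at time k. *)
Definition current (p0 : pstate) (ts : nat -> N.-tuple pstate) (k : nat) :
    pstate :=
  if k is k'.+1 then head p0 (ts k') else p0.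

(* The controller has been run successfully at times 0, ..., n, for some choice
   of the maximizers; [ts] is irrelevant beyond n. *)
Definition execution_upto (n : nat) (p0 : pstate)
    (ts : nat -> N.-tuple pstate) : Prop :=
  RH0 p0 (ts 0%N) /\
  forall k, (k < n)%N -> RH k.+1 (current p0 ts k.+1) (ts k) (ts k.+1).

Definition execution (p0 : pstate) (ts : nat -> N.-tuple pstate) : Prop :=
  RH0 p0 (ts 0%N) /\
  forall k, RH k.+1 (current p0 ts k.+1) (ts k) (ts k.+1).

Definition produced (p0 : pstate) (ts : nat -> N.-tuple pstate) (k : nat) : T :=
  (current p0 ts k).1.

End Product.

(* Main.v *)
(* Off [Fstar], an optimal first transition strictly decreases [V]; a prediction
   whose last state has finite energy can therefore be shifted by one step and
   prolonged, or prolonged from its first visit to [Fstar], which gives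
   recursive feasibility.  Were [V] eventually positive along an infinite
   execution, then either the first index at which the prediction meets [Fstar]
   or (as long as it does not) the energy of its last state would decrease
   forever, although both range over finite sets.  So [Fstar], hence the set of
   accepting states, is visited infinitely often. *)
Require Import Defs.
From mathcomp Require Import all_boot all_order all_algebra.
From mathcomp Require Import all_classical reals ereal.
Import Order.TTheory GRing.Theory Num.Theory.
Local Open Scope ring_scope.

(** * Repetition in infinite sequences over a finite set *)

Lemma infinitely_often_repeat (S : finType) (p : nat -> S) (P : pred S) :
  (forall n, exists m, (n <= m)%N /\ P (p m)) ->
  exists i j, [/\ (i < j)%N, P (p i) & p j = p i].
Proof.
move=> io.
have /choice [f fP] : forall n, exists m, (n <= m)%N /\ P (p m) by [].
(* [g] lists strictly increasing times at which [P] holds; two of the first [#|S| + 1] must share a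
   state. *)
pose g n := iter n (fun i => f i.+1) (f 0%N).
have gP n : P (p (g n)) by case: n => [|n]; [case: (fP 0%N) | case: (fP (g n).+1)].
have g_lt : {homo g : i j / (i < j)%N}.
  by apply: (homo_ltn ltn_trans) => i; case: (fP (g i).+1).
have /injectivePn [x [y xy pxy]] :
    ~~ injectiveb (fun i : 'I_(#|S|.+1) => p (g i)).
  apply/negP => /injectiveP /leq_card.
  by rewrite card_ord ltnn.
wlog xlty : x y xy pxy / (x < y)%N.
  move=> W; have [|yx|/val_inj exy] := ltngtP x y.
  - exact: W.
  - by apply: (W y x) => //; rewrite eq_sym.
  - by rewrite exy eqxx in xy.
by exists (g x), (g y); split; [exact: g_lt | exact: gP | rewrite pxy].
Qed.

(** Finiteness of [S] replaces well-foundedness of [D]: a repeated state would carry a value below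
    itself. *)
Lemma finite_no_descent {d} {D : porderType d} (S : finType) (v : S -> D)
    (p : nat -> S) :
  ~ (forall k, (v (p k.+1) < v (p k))%O).
Proof.
move=> dec.
have vlt : {homo v \o p : i j / (i < j)%N >-> (j < i)%O}.
  by apply: homo_ltn => // [y x z xy yz]; exact: lt_trans yz xy.
have [|i [j [ij _ pij]]] := @infinitely_often_repeat S p predT.
  by move=> n; exists n.
by have := vlt _ _ ij; rewrite /= pij ltxx.
Qed.

(** * The energy function *)

Section Energy.
Set Implicit Arguments.
Unset Strict Implicit.
Variables (R : realType) (Pi : Type) (T : dts R Pi) (B : buchi Pi).
Implicit Types (p q : pstate T B) (s : seq (pstate T B)).

Lemma path_weight_cons p q s :
  path_weight p (q :: s) = pweight p q + path_weight q s.
Proof. by rewrite /path_weight /= big_cons. Qed.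

Lemma pweight_gt0 p q : ptrans p q -> 0 < pweight p q.
Proof. by case/andP => /weight_gt0. Qed.

Lemma path_weight_ge0 p s : path (@ptrans R Pi T B) p s -> 0 <= path_weight p s.
Proof.
elim: s p => [|q s IH] p /=; first by rewrite /path_weight big_nil.
by case/andP=> pq qs; rewrite path_weight_cons addr_ge0 ?IH // ltW // pweight_gt0.
Qed.

Lemma V_Fstar p : p \in Fstar T B -> V p = 0%E.
Proof. by rewrite /V => ->. Qed.

Lemma V_ge0 p : (0 <= V p)%E.
Proof.
rewrite /V; case: ifP => // _; apply: le_ereal_inf_tmp => _ [s [ps _] <-].
by rewrite lee_fin path_weight_ge0.
Qed.

Lemma V_le_path_weight p s :
  path (@ptrans R Pi T B) p s -> last p s \in Fstar T B ->
  (V p <= (path_weight p s)%:E)%E.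
Proof.
move=> ps ls; rewrite /V; case: ifP => _; first by rewrite lee_fin path_weight_ge0.
by apply: ereal_inf_lbound; exists s.
Qed.

Lemma V_ltyP p :
  (V p < +oo)%E <-> exists2 f, f \in Fstar T B & connect (@ptrans R Pi T B) p f.
Proof.
split=> [|[f fF /connectP[s ps fE]]]; last first.
  by apply: le_lt_trans (ltry (path_weight p s)); rewrite V_le_path_weight // -fE.
rewrite /V; case: ifPn => [pF _|pF Vp]; first by exists p.
have [_ [s [ps ls] _] _] := ereal_inf_lt Vp.
by exists (last p s) => //; apply/connectP; exists s.
Qed.

Lemma V_lty_connect p q :
  connect (@ptrans R Pi T B) p q -> (V q < +oo)%E -> (V p < +oo)%E.
Proof.
move=> pq /V_ltyP[f fF qf]; apply/V_ltyP; exists f => //.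
exact: connect_trans qf.
Qed.

Lemma V_lty_path p q r s :
  path (@ptrans R Pi T B) p (q :: s) -> r \in q :: s -> (V r < +oo)%E ->
  (V q < +oo)%E.
Proof. by case/andP=> _ qs /(path_connect qs); exact: V_lty_connect. Qed.

(** A path from [p] to [Fstar] has a first transition, as [p] lies outside. Minimizing over the
    finitely many successors bounds all path weights from below, hence their infimum, without
    showing that it is attained. *)
Lemma V_Bellman p : p \notin Fstar T B -> (V p < +oo)%E ->
  exists2 q, ptrans p q & ((pweight p q)%:E + V q <= V p)%E.
Proof.
move=> pF Vp; have [f fF /connectP[[|q s] /= ps fE]] := (V_ltyP p).1 Vp.
  by rewrite -fE fF in pF.
have pq : ptrans p q by case/andP: ps.
pose c r := ((pweight p r)%:E + V r)%E.
case: (@Order.TotalTheory.arg_minP _ _ _ q (ptrans p) c pq) => r pr rmin.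
exists r => //; rewrite [V p]/V (negPf pF); apply: le_ereal_inf_tmp.
move=> _ [[|q' s'] [/= ps' ls'] <-]; first by rewrite ls' in pF.
have /andP[pq' qs'] := ps'.
apply: le_trans (rmin q' pq') _.
by rewrite path_weight_cons EFinD leeD2lE // V_le_path_weight.
Qed.

(** An infimum of positive weights might vanish; off [Fstar], [V_Bellman] bounds it below by the
    weight of one transition. *)
Lemma V_eq0 p : (V p == 0%E) = (p \in Fstar T B).
Proof.
apply/idP/idP => [/eqP Vp0|/V_Fstar -> //]; apply: contraT => pF.
have [|q pq] := V_Bellman pF; first by rewrite Vp0 ltry.
rewrite Vp0 leNgt => /negP[]; apply: lt_le_trans (leeDl _ (V_ge0 q)).
by rewrite lte_fin pweight_gt0.
Qed.

Lemma V_gt0 p : (0 < V p)%E = (p \notin Fstar T B).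
Proof. by rewrite lt_neqAle V_ge0 andbT eq_sym V_eq0. Qed.

Lemma V_descent p : p \notin Fstar T B -> (V p < +oo)%E ->
  exists2 q, ptrans p q & (V q < V p)%E.
Proof.
move=> pF Vp; have [q pq le] := V_Bellman pF Vp; exists q => //.
apply: lt_le_trans (le); have := V_ge0 q.
(* [V q] is finite because [V p] is, so adding the positive weight is strict. *)
case E: (V q) le => [r||] //= le _; last by have := le_lt_trans le Vp.
by rewrite -EFinD lte_fin ltrDr pweight_gt0.
Qed.

Lemma V_lty_succ p : (V p < +oo)%E -> exists2 q, ptrans p q & (V q < +oo)%E.
Proof.
move=> Vp; case: (boolP (p \in Fstar T B)) => [pF|/V_descent[]// q pq]; last first.
  by move=> qp; exists q => //; exact: lt_trans Vp.
have /existsP[q /andP[pq /exists_inP[f fF qf]]] :=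
  forall_inP (Fstar_self_reachable T B) p pF.
by exists q => //; apply/V_ltyP; exists f.
Qed.

Lemma V_lty_extend p n : (V p < +oo)%E ->
  exists s, [/\ path (@ptrans R Pi T B) p s, size s = n & (V (last p s) < +oo)%E].
Proof.
elim: n p => [|n IH] p Vp; first by exists [::].
have [q pq Vq] := V_lty_succ Vp; have [s [qs sn ls]] := IH q Vq.
by exists (q :: s); rewrite /= pq qs sn.
Qed.

(** * Feasibility of the optimization problems *)

Variables (N : nat) (rew : T -> nat -> R) (nbh : T -> nat -> {set T}).
Hypothesis N_gt0 : (0 < N)%N.
Implicit Types t prev : N.-tuple (pstate T B).

Lemma tuple_cons t p : exists s, val t = head p t :: s.
Proof.
by case: t => [[|q s] /= /eqP st]; [have := N_gt0; rewrite -st | exists s].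
Qed.

Lemma seq_tuple s : size s = N -> exists t, val t = s.
Proof. by move/eqP=> sN; exists (Tuple sN). Qed.

(** An accepting run of [B] along [q] lifts to the product, where some accepting state recurs by
    finiteness. *)
Lemma V_lty_pinit (q : nat -> T) (phi : ltl Pi) :
  buchi_for B phi -> trajectory q -> trajectory_sat q phi ->
  exists p, p \in pinit T B /\ (V p < +oo)%E.
Proof.
move=> Bphi [q0 qS] /Bphi[s [s0 sS acc]].
pose p k : pstate T B := (q k, s k).
have pS k : ptrans (p k) (p k.+1) by rewrite /ptrans qS sS.
have pconn i j : (i <= j)%N -> connect (@ptrans R Pi T B) (p i) (p j).
  elim: j => [|j IH]; first by rewrite leqn0 => /eqP->.
  rewrite leq_eqVlt => /predU1P[->//|/IH pij].
  exact: connect_trans pij (connect1 (pS j)).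
have [i [j [ij pi pji]]] :=
  @infinitely_often_repeat _ p [pred x | x.2 \in bacc B] acc.
exists (p 0%N); split; first by rewrite inE /= q0 eqxx.
apply/V_ltyP; exists (p i); last exact: pconn.
(* The cycle from [p i] to [p j = p i] makes the singleton self-reachable, so maximality of [Fstar]
   applies. *)
have /fintype.subsetP : [set p i] \subset Fstar T B; last first.
  by apply; rewrite inE.
apply: Fstar_max; first by rewrite finset.sub1set inE.
apply/forall_inP => x; rewrite inE => /eqP->.
apply/existsP; exists (p i.+1); rewrite pS; apply/exists_inP; exists (p i).
  by rewrite inE.
by rewrite -pji; exact: pconn.
Qed.

Lemma RH0_exists p : p \in pinit T B -> (V p < +oo)%E ->
  exists p0 t, RH0 rew nbh p0 t.
Proof.
move=> pI Vp; have [s [ps /seq_tuple[t ts] _]] := V_lty_extend N Vp.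
have adm : admissible0 (p, t).1 (p, t).2 by rewrite /admissible0 pI Vp inE /= ts.
pose x0 : pstate T B * N.-tuple (pstate T B) := (p, t).
case: (@Order.TotalTheory.arg_maxP _ _ _ x0 (fun x => admissible0 x.1 x.2)
  (fun x => predicted_reward rew nbh 0 x.1 x.2) adm) => -[p' t'] /= adm' tmax.
by exists p', t'; split=> // p'' t'' adm''; exact: (tmax (p'', t'')).
Qed.

Lemma RH_exists k p prev t : admissible p prev t ->
  exists t', RH rew nbh k p prev t'.
Proof.
move=> adm; case: (@Order.TotalTheory.arg_maxP _ _ _ t (admissible p prev)
  (predicted_reward rew nbh k p) adm) => t' adm' tmax.
by exists t'; split.
Qed.

Lemma admissible_exists q0 q prev : prev \in predicted N q0 ->
  (V (head q prev) < +oo)%E -> exists t, admissible (head q prev) prev t.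
Proof.
rewrite inE; have [s prevE] := tuple_cons prev q; move: prevE.
set p := head q prev => prevE; rewrite prevE /= => /andP[_ ps] Vp.
have sN : (size s).+1 = N by rewrite -(size_tuple prev) prevE.
rewrite /admissible /predicted; case: (boolP (p \in Fstar T B)) => pF.
  (* Case 3: any continuation of [p] that keeps the energy finite will do. *)
  have [e [pe /seq_tuple[t te] le]] := V_lty_extend N Vp; exists t.
  by rewrite inE V_gt0 pF /= te pe le implybT.
case: (boolP (has (fun p' => V p' == 0%E) prev)) => [hz|hz]; last first.
  suff [e [pe /seq_tuple[t te] le]] : exists e, [/\ path (@ptrans R Pi T B) p e,
      size e = N & (V (last p e) < V (last p prev))%E].
    exists t; rewrite inE [V p == 0%E]V_eq0 te pe le implybT (negPf pF) /=.
    by rewrite andbF.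
  have lF : last p s \notin Fstar T B.
    rewrite -V_eq0; apply: contraNN hz => hz; apply/hasP; exists (last p s) => //.
    by rewrite prevE mem_last.
  (* Case 1: if the previous end has infinite energy, any finite-energy continuation of [p] improves
     on it; otherwise append to [s] a successor of lower energy. *)
  rewrite prevE /=; case: (ltP (V (last p s)) +oo%E) => [Vl|]; last first.
    rewrite leye_eq => /eqP ->; have [e [pe en le]] := V_lty_extend N Vp.
    by exists e.
  have [r lr rl] := V_descent lF Vl.
  by exists (rcons s r); rewrite rcons_path ps lr size_rcons last_rcons.
(* Case 2: follow [prev] up to its first state in [Fstar], then continue with finite energy. As
   [prev] is [p :: s], its entry [j] is the end of [take j s], at index [j] of [p :: t]. *)
pose j := find (fun p' => V p' == 0%E) prev.
have jN : (j < N)%N by rewrite -[X in (_ < X)%N](size_tuple prev) -has_find.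
have js : (j <= size s)%N by rewrite -ltnS sN.
have Vj : last p (take j s) \in Fstar T B.
  rewrite -V_eq0 (last_nth p) size_takel //.
  have := nth_find p hz; rewrite -/j [X in nth _ X _]prevE.
  suff -> : nth p (p :: s) j = nth p (p :: take j s) j by [].
  by case: (j) => //= i; rewrite nth_take.
have [|e [je en le]] := @V_lty_extend (last p (take j s)) (N - j).
  by rewrite V_Fstar ?ltry.
have [|t te] := @seq_tuple (take j s ++ e).
  by rewrite size_cat en size_takel // subnKC // ltnW.
exists t; rewrite inE [V p == 0%E]V_eq0 (negPf pF) V_gt0 pF te cat_path je andbT /=.
have -> : all (fun p' => V p' != 0%E) prev = false.
  by rewrite (all_predC (fun p' => V p' == 0%E)) hz.
rewrite take_path //= andbT -cat_cons nth_cat /= size_takel // ltnSn -/j.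
by rewrite -[X in nth _ _ X](size_takel js) -last_nth V_Fstar.
Qed.

(* The index constrained in Case 2 is positive because [first_zero prev = 1]
   would put [head q prev] in [Fstar]. *)
Lemma admissible_case2 q prev t (p := head q prev) :
  p \notin Fstar T B -> has (fun p' => V p' == 0%E) prev ->
  admissible p prev t ->
  exists2 i, (i.+1 = find (fun p' => V p' == 0%E) prev) &
    (i < N)%N /\ (V (nth p t i) = 0%E).
Proof.
have [s prevE] := tuple_cons prev q; rewrite -/p in prevE.
move=> pF hz /and4P[_ _ /implyP + _]; rewrite V_gt0 pF hz => /(_ isT) /eqP.
rewrite /first_zero /=; have : (find (fun p' => V p' == 0%E) prev < N)%N.
  by rewrite -[X in (_ < X)%N](size_tuple prev) -has_find.
case E: (find _ _) => [|i] /= iN Vi.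
  by move: E; rewrite prevE /= V_eq0 (negPf pF).
by exists i => //; split=> //; exact: ltnW.
Qed.

(** In each case the constraint puts a state of finite energy on [t], and the head of [t] reaches
    it. *)
Lemma admissible_lty q prev t (p := head q prev) :
  admissible p prev t -> (V (head p t) < +oo)%E.
Proof.
move=> adm; have /and4P[+ /implyP c1 _ /implyP c3] := adm.
have [s tE] := tuple_cons t p; rewrite inE tE => pt.
have lt : last p t \in head p t :: s by rewrite tE /= mem_last.
case: (boolP (p \in Fstar T B)) => pF.
  by apply: (V_lty_path pt lt); apply: c3; rewrite V_Fstar.
case: (boolP (has (fun p' => V p' == 0%E) prev)) => [hz|]; last first.
  rewrite -all_predC V_gt0 pF in c1 * => /c1 ltl.
  by apply: (V_lty_path pt lt); apply: lt_le_trans ltl (leey _).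
have [i _ [iN Vi]] := admissible_case2 pF hz adm.
apply: (@V_lty_path _ _ (nth p t i) _ pt); last by rewrite Vi ltry.
by rewrite -tE mem_nth // size_tuple.
Qed.

(** * Executions and their visits to [Fstar] *)

Lemma execution_upto_lty n p0 (ts : nat -> N.-tuple (pstate T B)) :
  execution_upto rew nbh n p0 ts -> (0 < n)%N ->
  (V (current p0 ts n.+1) < +oo)%E.
Proof.
(* The bound comes from the last [RH] step; [RH0] constrains only the energy of the initial
   state. *)
case: n => // n [_ /(_ n (ltnSn n)) [adm _]] _.
have /= := admissible_lty adm.
by have [s ->] := tuple_cons (ts n.+1) p0.
Qed.

Lemma execution_predicted n p0 (ts : nat -> N.-tuple (pstate T B)) :
  execution_upto rew nbh n p0 ts -> ts n \in predicted N (current p0 ts n).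
Proof.
by case: n => [|n] [[/and3P[_ _ t0] _] RHs] //; have [/and4P[]] := RHs n (ltnSn n).
Qed.

Lemma execution_ptrans p0 (ts : nat -> N.-tuple (pstate T B)) k :
  execution rew nbh p0 ts ->
  ptrans (current p0 ts k) (current p0 ts k.+1).
Proof.
case=> ex0 ex; have : execution_upto rew nbh k p0 ts by split.
move/execution_predicted; rewrite inE /=.
by have [s ->] := tuple_cons (ts k) p0 => /andP[].
Qed.

Lemma execution_Fstar p0 (ts : nat -> N.-tuple (pstate T B)) :
  execution rew nbh p0 ts ->
  forall n, exists m, (n <= m)%N /\ current p0 ts m \in Fstar T B.
Proof.
move=> [_ ex] n; apply: contrapT => nF.
pose z t := has (fun p' : pstate T B => V p' == 0%E) t.
pose f t := find (fun p' : pstate T B => V p' == 0%E) t.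
have pF k : current p0 ts (n + k).+1 \notin Fstar T B.
  apply/negP => F; apply: nF; exists (n + k).+1; split=> //.
  by rewrite -addnS leq_addr.
(* By Case 2, a prediction first meeting [Fstar] at index [i.+1] is followed by one already in
   [Fstar] at index [i]. *)
have step k : z (ts (n + k)%N) ->
    z (ts (n + k.+1)%N) /\ (f (ts (n + k.+1)%N) < f (ts (n + k)%N))%N.
  move=> zk; rewrite addnS; have [adm _] := ex (n + k)%N.
  have [i iE [iN Vi]] := admissible_case2 (pF k) zk adm.
  have it : (i < size (ts (n + k).+1))%N by rewrite size_tuple.
  split; first by apply/hasP; exists (nth (current p0 ts (n + k).+1)
    (ts (n + k).+1) i); [exact: mem_nth | exact/eqP].
  rewrite [X in (_ < X)%N]/f -iE ltnS leqNgt; apply/negP.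
  by move=> /(before_find (current p0 ts (n + k).+1)); rewrite Vi eqxx.
case: (EM (exists k, z (ts (n + k)%N))) => [[k zk]|nz].
  (* The index starts at most at [N] and drops at every step, which is absurd after [N.+1] steps. *)
  have zf i : z (ts (n + (k + i))%N) /\ (f (ts (n + (k + i))%N) + i <= N)%N.
    elim: i => [|i [zi fi]].
      by rewrite !addn0 -[X in (_ <= X)%N](size_tuple (ts (n + k)%N)) find_size.
    have [zi' fi'] := step _ zi; rewrite addnS; split=> //.
    by rewrite addnS; apply: leq_trans fi; rewrite ltn_add2r.
  by have [_] := zf N.+1; rewrite leqNgt leq_addl.
(* No prediction from time [n] on meets [Fstar], so Case 1 applies at every step. *)
apply: (@finite_no_descent _ _ _ (@V R Pi T B)
  (fun k => last p0 (ts (n + k)%N))) => k.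
have last_ts i x : last x (ts i) = last p0 (ts i).
  by have [s ->] := tuple_cons (ts i) p0.
have [/and4P[_ /implyP + _ _] _] := ex (n + k)%N.
rewrite V_gt0 pF !last_ts addnS; apply.
by rewrite (all_predC (fun p' => V p' == 0%E)); apply/negP => zk; apply: nz; exists k.
Qed.

End Energy.

Theorem mainTheorem2 (R : realType) (Pi : Type) (T : dts R Pi) (phi : ltl Pi)
    (B : buchi Pi) (N : nat) (rew : T -> nat -> R) (nbh : T -> nat -> {set T}) :
  non_blocking T ->
  buchi_for B phi ->
  (0 < N)%N ->
  (forall q k, 0 <= rew q k) ->
  (exists q : nat -> T, trajectory q /\ trajectory_sat q phi) ->
  [/\ (* the algorithm does not report that no run satisfies phi *)
      exists p0 : pstate T B, p0 \in pinit T B /\ (V p0 < +oo)%E,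
      (* the optimization problem at time 0 is solvable *)
      exists (p0 : pstate T B) (t : N.-tuple (pstate T B)), RH0 rew nbh p0 t,
      (* after any execution up to time n, the problem at time n+1 is solvable;
         at n = 0 this requires the state reached to have finite energy, which
         the constraints at time 0 do not enforce *)
      forall (n : nat) (p0 : pstate T B) (ts : nat -> N.-tuple (pstate T B)),
        execution_upto rew nbh n p0 ts ->
        (n = 0%N -> (V (current p0 ts 1) < +oo)%E) ->
        exists t : N.-tuple (pstate T B),
          RH rew nbh n.+1 (current p0 ts n.+1) (ts n) t &
      (* every infinite execution produces a satisfying trajectory *)
      forall (p0 : pstate T B) (ts : nat -> N.-tuple (pstate T B)),
        execution rew nbh p0 ts ->
        trajectory (produced p0 ts) /\ trajectory_sat (produced p0 ts) phi].

Proof.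
move=> _ Bphi N_gt0 _ [q [qT qphi]].
have [p0 [p0I Vp0]] := V_lty_pinit Bphi qT qphi.
split.
- by exists p0.
- exact: RH0_exists p0I Vp0.
- move=> n p ts ex n0.
  have Vn : (V (current p ts n.+1) < +oo)%E.
    by case: n ex n0 => [_ ->//|n ex _]; apply: (execution_upto_lty N_gt0 ex).
  have [t adm] := admissible_exists N_gt0 (execution_predicted ex) Vn.
  exact: RH_exists adm.
- move=> p ts ex; have tr k := execution_ptrans N_gt0 k ex.
  have [[/and3P[+ _ _] _] _] := ex; rewrite inE => /andP[/eqP pi pb].
  split; first by split=> // k; case/andP: (tr k).
  (* The automaton component of the execution is an accepting run. *)
  apply/Bphi; exists (fun k => (current p ts k).2); split=> // [k|n].
    by case/andP: (tr k).
  have [m [nm mF]] := execution_Fstar N_gt0 ex n; exists m; split=> //.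
  by have := fintype.subsetP (Fstar_sub T B) _ mF; rewrite inE.
Qed.
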